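(* Let $d\ge 2$ be an integer and let $X\subset\mathbb{P}^d$ be the rational normal curve (of degree $d$). Let $q\in\mathbb{P}^d$ be any point such that $\mathcal{S}(X,q)$ is not a singleton. Then $W_q=\{q\}$. Moreover, if $\mathcal{S}(X,q)=\mathcal{S}(X,q')$ for some $q'\in\mathbb{P}^d$, then $q'=q$.
   Context: The base field is algebraically closed of characteristic $0$ (e.g. $\mathbb{C}$). For a set $A\subset\mathbb{P}^d$, $\langle A\rangle$ denotes its linear span. For an integral and non-degenerate variety $X\subset\mathbb{P}^d$ and $q\in\mathbb{P}^d$, the $X$-rank $r_X(q)$ is the minimal cardinality of a finite set $S\subset X$ such that $q\in\langle S\rangle$; $\mathcal{S}(X,q)$ is the set of all $S\subset X$ such that $|S|=r_X(q)$ and $q\in\langle S\rangle$; and $W_q=W(X)_q:=\bigcap_{S\in\mathcal{S}(X,q)}\langle S\rangle$. *)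

(* Defs.v *)
From HB Require Import structures.
From mathcomp Require Import all_boot all_order all_algebra finmap.
From mathcomp Require Import boolp classical_sets.

Set Implicit Arguments.
Unset Strict Implicit.
Unset Printing Implicit Defensive.

Import GRing.Theory.
Local Open Scope classical_set_scope.
Local Open Scope ring_scope.

(* The points of P^d are the lines through the origin of K^(d+1), so that
   Leibniz equality is equality of points. *)
Record proj_space (K : fieldType) (d : nat) := ProjPoint {
  proj_line : {vspace 'rV[K]_d.+1};
  _ : \dim proj_line == 1%N
}.

HB.instance Definition _ (K : fieldType) (d : nat) :=
  [isSub for @proj_line K d].
HB.instance Definition _ (K : fieldType) (d : nat) :=
  [Choice of proj_space K d by <:].

Section ProjectiveGeometry.
Variables (K : fieldType) (d : nat).
Implicit Types (A X : set (proj_space K d)) (q : proj_space K d)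
  (S : {fset proj_space K d}).

(* <A>, as a set of points: the intersection of all the projective linear
   subspaces that contain A. *)
Definition linear_span A : set (proj_space K d) :=
  [set q | forall U : {vspace 'rV[K]_d.+1},
     (forall p, A p -> (proj_line p <= U)%VS) -> (proj_line q <= U)%VS].

Definition spanning_set X q S : Prop :=
  [set` S] `<=` X /\ linear_span [set` S] q.

(* The value 0 in the last branch is only taken when q is not in <X>, hence
   never for a non-degenerate X. *)
Definition X_rank X q : nat :=
  if pselect (exists n, `[< exists2 S, spanning_set X q S & #|` S| = n >])
    is left exn then ex_minn exn else 0%N.

Definition rank_sets X q : set {fset proj_space K d} :=
  [set S | spanning_set X q S /\ #|` S| = X_rank X q].

Definition rank_locus X q : set (proj_space K d) :=
  \bigcap_(S in rank_sets X q) linear_span [set` S].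

Definition veronese (s t : K) : 'rV[K]_d.+1 :=
  \row_(i < d.+1) (s ^+ (d - i) * t ^+ i).

(* Rational normal curves are taken up to projective equivalence: the matrix g
   is the coordinate change from the standard one. *)
Definition rational_normal_curve X : Prop :=
  exists2 g : 'M[K]_d.+1, g \in unitmx &
    X = [set p | exists s t : K,
           (s, t) != (0, 0) /\ proj_line p = <[veronese s t *m g]>%VS].

End ProjectiveGeometry.

(* Main.v *)
(* By duality the point q is a linear functional L on binary forms of degree d,
   and a finite subset T of the curve spans q iff L kills all the multiples in
   degree d of the squarefree form vanishing on T (Sylvester's apolarity). Let
   g1 be a nonzero form of least degree a all of whose multiples are killed by
   L. Catalecticant ranks give a second such form g2 of degree b = d + 2 - a >=
   a, not a multiple of g1; g1 and g2 are coprime, and their multiples in degree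
   d make up a hyperplane, which is thus the kernel of L. Below degree b, the
   apolar forms are the multiples of g1, so two different minimal sets T force
   the rank to be b and a > 1. By Wronskians almost all members g1 w + c g2 of a
   pencil with w coprime to g2 are squarefree, hence come from minimal sets; a
   point in the span of all of these has a functional killing the multiples of
   g1 and g2, hence proportional to L. *)
From HB Require Import structures.
Require Import Defs.
From mathcomp Require Import all_boot all_order all_algebra finmap.
From mathcomp Require Import boolp classical_sets.
From mathcomp Require Import separable ring zify.

Set Implicit Arguments.
Unset Strict Implicit.
Unset Printing Implicit Defensive.

Import GRing.Theory.
Local Open Scope classical_set_scope.
Local Open Scope ring_scope.

(** * Functionals on binary forms and their catalecticant matrices *)

Section Apolarity.
Variable K : fieldType.
Implicit Types (L M : {scalar {poly K}}) (f g u v w p : {poly K}).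

(* A polynomial of size at most [k.+1] stands for a binary form of degree [k],
   the missing degree being its order of vanishing at infinity. *)
Definition annihilates L n g := forall u, (size u <= n)%N -> L (g * u) = 0.

Lemma size_mul_leqS p u m n : (size p <= m.+1)%N -> (size u <= n)%N ->
  (size (p * u)%R <= m + n)%N.
Proof.
by move=> sp su; have := size_polyMleq p u; lia.
Qed.

Lemma annihilatesXn L n g :
  (forall i : 'I_n, L (g * 'X^i) = 0) -> annihilates L n g.
Proof.
move=> h u su; rewrite -(poly_rV_K su) /rVpoly poly_def mulr_sumr linear_sum.
rewrite big1 // => i _; rewrite -scalerAr linearZ /=.
by rewrite h mulr0.
Qed.

(** The catalecticant matrix of [L]. *)
Definition hankel L m n : 'M[K]_(m, n) :=
  \matrix_(i < m, j < n) L ('X^i * 'X^j).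

Lemma tr_hankel L m n : (hankel L m n)^T = hankel L n m.
Proof. by apply/matrixP=> i j; rewrite !mxE mulrC. Qed.

Lemma mul_hankelP L m n (v : 'rV[K]_m) :
  v *m hankel L m n = 0 <-> annihilates L n (rVpoly v).
Proof.
have E (j : 'I_n) : (v *m hankel L m n) 0 j = L (rVpoly v * 'X^j).
  rewrite mxE -{2}[v]rVpolyK poly_rV_K ?size_poly // /rVpoly poly_def.
  rewrite mulr_suml linear_sum; apply: eq_bigr => i _.
  by rewrite mxE -scalerAl linearZ /= valK.
split=> [h | h]; first by apply: annihilatesXn => i; rewrite -E h mxE.
by apply/rowP=> j; rewrite E h ?mxE // size_polyXn.
Qed.

Definition multiples_mx g m n : 'M[K]_(m, n) :=
  \matrix_(i < m) poly_rV (g * 'X^i).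

Lemma mul_multiples_mx g m n (v : 'rV[K]_m) :
  v *m multiples_mx g m n = poly_rV (g * rVpoly v).
Proof.
rewrite mulmx_sum_row /rVpoly poly_def mulr_sumr linear_sum.
by apply: eq_bigr => i _; rewrite rowK -scalerAr linearZ /= valK.
Qed.

(** There is one more coefficient than there are linear conditions. *)
Lemma exists_poly_kernel n (phi : 'I_n -> {scalar {poly K}}) :
  exists p, [/\ p != 0, (size p <= n.+1)%N & forall i, phi i p = 0].
Proof.
pose A : 'M[K]_(n.+1, n) := \matrix_(j, i) phi i 'X^j.
have /rowV0Pn[v /sub_kermxP vA v0] : kermx A != 0.
  by rewrite kermx_eq0 /row_free neq_ltn ltnS rank_leq_col.
exists (rVpoly v); split=> [||i].
- by apply: contra v0 => /eqP h; rewrite -[v]rVpolyK h linear0.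
- exact: size_poly.
have := congr1 (fun B : 'rV_n => B 0 i) vA; rewrite !mxE => <-.
rewrite /rVpoly poly_def linear_sum; apply: eq_bigr => j _.
by rewrite linearZ /= valK mxE.
Qed.

(** * Generators of the apolar ideal; in the application [a + b = d + 2] *)

Section Generators.
Variables (L : {scalar {poly K}}) (a b : nat).
Hypothesis nondeg : forall f, (size f <= a)%N -> annihilates L b f -> f = 0.

Lemma row_free_hankel : row_free (hankel L a b).
Proof.
apply: inj_row_free => v /mul_hankelP h.
by rewrite -[v]rVpolyK (nondeg _ h) ?size_poly ?linear0.
Qed.

Lemma nondeg_leq : (a <= b)%N.
Proof.
by have := rank_leq_col (hankel L a b); rewrite (eqP row_free_hankel).
Qed.

Variable g1 : {poly K}.
Hypotheses (g1_neq0 : g1 != 0) (sg1 : (size g1 <= a.+1)%N)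
  (g1L : annihilates L b.-1 g1).

(** A dimension count: the multiples of [g1] lie in the kernel of the [b] by [a] catalecticant, and
    both spaces have dimension [b - a], because the transposed matrix has full row rank. *)
Lemma annihilated_multiple g : (size g <= b)%N -> annihilates L a g ->
  exists2 w, g = g1 * w & (size w <= b - a)%N.
Proof.
move=> sg gL; have leab := nondeg_leq.
have sgw w : (size w <= b - a)%N -> (size (g1 * w)%R <= b)%N.
  by move=> sw; rewrite -(subnKC leab) size_mul_leqS.
pose H := hankel L b a; pose G := multiples_mx g1 (b - a) b.
have rfG : row_free G.
  apply: inj_row_free => v; rewrite mul_multiples_mx => /(congr1 rVpoly).
  rewrite linear0 poly_rV_K ?sgw ?size_poly // => /eqP.
  rewrite mulf_eq0 (negPf g1_neq0) /= => /eqP h.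
  by rewrite -[v]rVpolyK h linear0.
have sGH : (G <= kermx H)%MS.
  apply/sub_kermxP/row_matrixP=> i; rewrite row0 row_mul rowK.
  apply/mul_hankelP; have si : (size ('X^i : {poly K}) <= b - a)%N.
    by rewrite size_polyXn.
  rewrite poly_rV_K ?sgw // => u su; rewrite -mulrA g1L //.
  rewrite (leq_trans (size_mul_leqS (m := i) _ su)) ?size_polyXn //.
  by have := ltn_ord i; lia.
have rH : \rank (kermx H) = (b - a)%N.
  by rewrite mxrank_ker /H -tr_hankel mxrank_tr (eqP row_free_hankel).
have : (poly_rV g <= G)%MS.
  apply: (@submx_trans _ _ _ _ _ _ (kermx H)).
    by apply/sub_kermxP/mul_hankelP; rewrite poly_rV_K.
  by rewrite -(geq_leqif (mxrank_leqif_sup sGH)) rH (eqP rfG).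
case/submxP=> v; rewrite mul_multiples_mx => /(congr1 rVpoly).
rewrite !poly_rV_K ?sgw ?size_poly // => ->.
by exists (rVpoly v); rewrite ?size_poly.
Qed.

(** The form is raised to degree [b - 1] in two ways. Taking [g] itself, with extra zeros at
    infinity, gives the quotient [w]; taking [g * 'X^m] then bounds the size of [w * 'X^m], which
    improves the bound on [w] by [m]. *)
Lemma annihilated_multiple_low k g : (k < b)%N -> (size g <= k.+1)%N ->
  annihilates L (a + b - k.+1) g ->
  exists2 w, g = g1 * w & (size w <= k.+1 - a)%N.
Proof.
move=> ltkb sg gL; set m := (b - k.+1)%N.
have [u su|w gE _] := annihilated_multiple (leq_trans sg ltkb).
  by apply: gL; rewrite (leq_trans su) // -addnBA ?leq_addr.
exists w => //.
have [|u su|w' gE'] := @annihilated_multiple (g * 'X^m).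
- rewrite (leq_trans (size_polyMleq _ _)) // size_polyXn addnS /=.
  by rewrite (leq_trans (leq_add sg (leqnn _))) // subnKC.
- rewrite -mulrA gL // (leq_trans (size_mul_leqS (m := m) _ su)) //.
    by rewrite size_polyXn.
  by rewrite /m; lia.
move: gE'; rewrite {1}gE -mulrA => /(mulfI g1_neq0) <-.
have [->|w0] := eqVneq w 0; first by rewrite size_poly0.
by rewrite size_mulXn // /m; lia.
Qed.

(** There are [b + 1] coefficients for [b] conditions: [a - 1] make [g2] apolar, and [b - a + 1]
    kill its coefficients at every index where a nonzero [g1 * w] could have its leading one. *)
Lemma exists_second_generator : (0 < a)%N ->
  exists g2, [/\ (size g2 <= b.+1)%N, annihilates L a.-1 g2 &
    forall w, (size w <= (b - a).+1)%N -> g2 <> g1 * w].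
Proof.
move=> a_gt0; have leab := nondeg_leq.
pose s := (size g1).-1.
pose phi (i : 'I_b) : {scalar {poly K}} :=
  if (i < a.-1)%N then (L \o ('X^i \*o idfun) : {scalar {poly K}})
  else (coefp (s + (i - a.-1))%N : {scalar {poly K}}).
have [g2 [g20 sg2 phig2]] := exists_poly_kernel phi.
have sg1E : size g1 = s.+1 by rewrite /s prednK // size_poly_gt0.
exists g2; split=> //.
  apply: annihilatesXn => i; have ltib : (i < b)%N.
    by have := ltn_ord i; lia.
  by have := phig2 (Ordinal ltib); rewrite /phi /= ltn_ord /= mulrC.
move=> w sw g2E; have w0 : w != 0.
  by apply: contra g20 => /eqP w0; rewrite g2E w0 mulr0.
have swE : size w = (size w).-1.+1 by rewrite prednK // size_poly_gt0.
have ltib : (a.-1 + (size w).-1 < b)%N by lia.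
have := phig2 (Ordinal ltib); rewrite /phi /= ltnNge leq_addr /= /coefp addKn.
move/eqP; rewrite -[_`_ _]/(g2`_ _) => /eqP.
have -> : (s + (size w).-1 = (size g2).-1)%N.
  by rewrite g2E size_mul // sg1E swE /= addnS.
by move/eqP; rewrite -[_`_ _]/(lead_coef g2) lead_coef_eq0 (negPf g20).
Qed.

End Generators.

(* A common linear factor [l] of both generators (with [l = 1] at infinity)
   would make [g1 / l] and [g2 / l] generators for the functional
   [u |-> L (l * u)], whose first nonzero apolar form has degree [a - 1]. *)
Lemma no_common_factor L a b g1 g2 l :
    (0 < a)%N ->
    (forall f, (size f <= a)%N -> annihilates L b f -> f = 0) ->
    annihilates L b.-1 (l * g1) -> annihilates L a.-1 (l * g2) ->
    l != 0 -> (size l <= 2)%N -> g1 != 0 ->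
    (size g1 <= a)%N -> (size g2 <= b)%N ->
  exists2 w, l * g2 = l * g1 * w & (size w <= (b - a).+1)%N.
Proof.
move=> a_gt0 nd g1L g2L l0 sl g10 sg1 sg2.
pose L' : {scalar {poly K}} := L \o (l \*o idfun).
have aE : a = a.-1.+1 by rewrite prednK.
have L'P n g : annihilates L n (l * g) -> annihilates L' n g.
  by move=> h u su; rewrite /L' /= mulrA h.
have nd' f : (size f <= a.-1)%N -> annihilates L' b f -> f = 0.
  move=> sf fL; have : l * f = 0.
    apply: nd; first by rewrite aE -add1n size_mul_leqS.
    by move=> u su; rewrite -mulrA; apply: fL.
  by move/eqP; rewrite mulf_eq0 (negPf l0) /= => /eqP.
have [] := annihilated_multiple nd' g10 _ (L'P _ _ g1L) sg2 (L'P _ _ g2L).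
  by rewrite -aE.
by move=> w -> sw; exists w; rewrite ?mulrA //; lia.
Qed.

(** The [b - 1] shifts of [g1] and the [a - 1] shifts of [g2] are independent, so they span a
    hyperplane of the polynomials of size at most [a + b - 1]. Functionals vanishing on it form a
    line, spanned by [L]. *)
Lemma annihilators_proportional L M a b g1 g2 :
    (0 < a)%N -> (0 < b)%N -> coprimep g1 g2 ->
    (size g1 <= a.+1)%N -> (size g2 <= b.+1)%N -> g1 != 0 ->
    (a < size g1)%N || (b < size g2)%N ->
    annihilates L b.-1 g1 -> annihilates L a.-1 g2 ->
    annihilates M b.-1 g1 -> annihilates M a.-1 g2 ->
    (exists2 p : {poly K}, (size p <= (a + b).-1)%N & L p != 0) ->
  exists c, forall p : {poly K}, (size p <= (a + b).-1)%N -> M p = c * L p.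
Proof.
move=> a_gt0 b_gt0 cop sg1 sg2 g10 full L1 L2 M1 M2 [p0 sp0 Lp0].
set n := (a + b).-1.
pose row_of (F : {scalar {poly K}}) : 'rV[K]_n := \row_i F 'X^i.
have row_ofE F p : (size p <= n)%N -> (poly_rV p *m (row_of F)^T) 0 0 = F p.
  move=> sp; rewrite -{2}(poly_rV_K sp) /rVpoly poly_def linear_sum mxE.
  by apply: eq_bigr => i _; rewrite linearZ /= valK !mxE.
pose B := col_mx (multiples_mx g1 b.-1 n) (multiples_mx g2 a.-1 n).
have sM1 w : (size w <= b.-1)%N -> (size (g1 * w)%R <= n)%N.
  by move=> sw; have := size_mul_leqS sg1 sw; rewrite /n; lia.
have sM2 w : (size w <= a.-1)%N -> (size (g2 * w)%R <= n)%N.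
  by move=> sw; have := size_mul_leqS sg2 sw; rewrite /n; lia.
have rfB : row_free B.
  apply: inj_row_free => v; rewrite -[v]hsubmxK mul_row_col !mul_multiples_mx.
  set v1 := lsubmx v; set v2 := rsubmx v => /(congr1 rVpoly).
  rewrite linear0 linearD /= !poly_rV_K ?sM1 ?sM2 ?size_poly // => /eqP.
  rewrite addr_eq0 => /eqP e.
  have : g1 %| rVpoly v2.
    by rewrite -(Gauss_dvdpr _ cop) -dvdpNr -e dvdp_mulIl.
  (* Otherwise the sizes of [g1 * w] and [g2 * w] bound those of [g1] and [g2] by [a] and [b]: a
     common zero at infinity, which [full] forbids. *)
  case/dvdpP=> w e2; have w0 : w = 0.
    apply/eqP/negPn/negP => w0.
    have e1 : rVpoly v1 = - (g2 * w).
      by apply: (mulfI g10); rewrite e e2; ring.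
    have := size_poly (a.-1) (fun k => if insub k is Some i then v2 0 i else 0).
    rewrite -[\poly_(_ < _) _]/(rVpoly v2) e2 size_mul // => s2.
    have := size_poly (b.-1) (fun k => if insub k is Some i then v1 0 i else 0).
    rewrite -[\poly_(_ < _) _]/(rVpoly v1) e1 size_polyN.
    have sg10 : (0 < size g1)%N by rewrite size_poly_gt0.
    have sw0 : (0 < size w)%N by rewrite size_poly_gt0.
    have [g20|g20] := eqVneq g2 0.
      move: cop full; rewrite g20 coprimep0 => /eqp_size ->.
      by rewrite size_poly1 size_poly0; lia.
    rewrite size_mul // => s1.
    move: full s1 s2 sw0 => /=.
    by move: (size w) (size g1) (size g2) => i j k; lia.
  move: e; rewrite e2 w0 mul0r mulr0 oppr0 => /eqP.
  rewrite mulf_eq0 (negPf g10) /= => /eqP e1.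
  by rewrite -[v1]rVpolyK e1 -[v2]rVpolyK e2 w0 mul0r !linear0 row_mx0.
have kerB F : annihilates F b.-1 g1 -> annihilates F a.-1 g2 ->
    (row_of F <= kermx B^T)%MS.
  move=> F1 F2; apply/sub_kermxP/trmx_inj; rewrite trmx_mul trmxK trmx0.
  rewrite mul_col_mx -[0]vsubmxK; congr col_mx; apply/row_matrixP=> i.
    rewrite row_mul rowK; apply/rowP=> j; rewrite ord1 row_ofE.
      by rewrite F1 ?size_polyXn // !mxE.
    by rewrite sM1 // size_polyXn.
  rewrite row_mul rowK; apply/rowP=> j; rewrite ord1 row_ofE.
    by rewrite F2 ?size_polyXn // !mxE.
  by rewrite sM2 // size_polyXn.
have rk : \rank (kermx B^T) = 1%N.
  by rewrite mxrank_ker mxrank_tr (eqP rfB) /n; lia.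
have L0 : row_of L != 0.
  apply: contra Lp0 => /eqP h; rewrite -(row_ofE _ _ sp0) h.
  by rewrite trmx0 mulmx0 mxE.
have : (row_of M <= row_of L)%MS.
  apply: submx_trans (kerB M M1 M2) _.
  by rewrite -(geq_leqif (mxrank_leqif_sup (kerB L L1 L2))) rk rank_rV L0.
case/sub_rVP=> c cE; exists c => p sp.
by rewrite -!row_ofE // cE linearZ /= -scalemxAr mxE.
Qed.

End Apolarity.

(** * Finite subsets of the projective line and squarefree forms *)

Section BinaryForms.
Variable K : closedFieldType.
Implicit Types (f g p u w : {poly K}) (T : seq (option K)).

(** Euclid's argument: [p] takes the value 1 on [s], so its roots lie outside. The factor ['X] keeps
    [p] nonconstant when [s] is empty. *)
Lemma exists_notin (s : seq K) : exists c, c \notin s.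
Proof.
pose p : {poly K} := \prod_(x <- s) ('X - x%:P) * 'X + 1.
have sp : size p != 1%N.
  have sX : size (\prod_(x <- s) ('X - x%:P) * 'X) = (size s).+2.
    by rewrite size_mulX ?monic_neq0 ?monic_prod_XsubC // size_prod_XsubC.
  by rewrite size_polyDl sX // size_poly1.
have [c pc] := closed_rootP p sp; exists c; apply/negP => cs; move: pc.
rewrite rootE !hornerE (_ : _.[c] = 0) ?mul0r ?add0r ?oner_eq0 //.
by apply/rootP; rewrite root_prod_XsubC.
Qed.

Lemma exists_uniq_seq n : exists s : seq K, uniq s /\ size s = n.
Proof.
elim: n => [|n [s [us <-]]]; first by exists [::].
by have [c cs] := exists_notin s; exists (c :: s); rewrite /= cs.
Qed.

Lemma closed_coprimep p g : (forall x, root p x -> g.[x] != 0) -> coprimep p g.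
Proof. exact: Pdiv.ClosedField.root_coprimep. Qed.

(* [Some x] is an affine point of P^1 and [None] is the point at infinity. *)
Definition form_of T : {poly K} := \prod_(x <- pmap id T) ('X - x%:P).

Lemma form_of_map_Some (s : seq K) :
  form_of (map Some s) = \prod_(x <- s) ('X - x%:P).
Proof. by rewrite /form_of; congr bigop; elim: s => //= x s ->. Qed.

Lemma size_form_of T : uniq T ->
  size (form_of T) = (size T + (None \notin T))%N.
Proof.
rewrite /form_of size_prod_XsubC size_pmap => uT.
rewrite -(count_predC isSome T) -addnA -addn1; congr addn.
have -> : count (predC isSome) T = count_mem None T by apply: eq_count => -[].
by rewrite (count_uniq_mem _ uT); case: (None \in T).
Qed.

Lemma form_of_monic T : form_of T \is monic.
Proof. exact: monic_prod_XsubC. Qed.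

Lemma root_form_of T x : root (form_of T) x = (Some x \in T).
Proof. by rewrite root_prod_XsubC mem_pmap map_id. Qed.

(** The roots give the affine points, and the drop in degree tells whether infinity belongs to the
    set. *)
Lemma form_of_inj T1 T2 : uniq T1 -> uniq T2 -> size T1 = size T2 ->
  form_of T1 %= form_of T2 -> T1 =i T2.
Proof.
move=> u1 u2 s12 e12 [x|].
  by rewrite -!root_form_of (eqp_root e12).
have := eqp_size e12; rewrite !size_form_of // s12 => /addnI.
by case: (None \in T1) (None \in T2) => -[].
Qed.

(** The roots of [g] are distinct. As [T] contains infinity at most once, the size bounds leave [a]
    or [a - 1] of them; in the second case infinity is the missing zero. *)
Lemma form_of_divisor T g u a : uniq T -> form_of T = g * u ->
  (size g <= a.+1)%N -> (size u <= (size T).+1 - a)%N ->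
  exists T', [/\ uniq T', size T' = a & form_of T' %= g].
Proof.
move=> uT e sg su.
have : g %| form_of T by rewrite e dvdp_mulr.
case/dvdp_prod_XsubC => m; set s := mask m _ => gE.
have us : uniq s by rewrite mask_uniq // (@pmap_uniq _ _ id Some) //; case.
have {}gE : g %= form_of (map Some s).
  by rewrite form_of_map_Some.
have sT : (size T < size g + size u)%N.
  have := size_form_of uT; have := size_polyMleq g u; rewrite -e.
  have : (0 < size (form_of T))%N.
    by rewrite size_poly_gt0 monic_neq0 ?form_of_monic.
  by case: (None \in T); rewrite /=; lia.
have sgs := eqp_size gE; rewrite form_of_map_Some size_prod_XsubC in sgs.
have u_gt0 : (0 < size u)%N.
  rewrite size_poly_gt0; apply: contraTneq (form_of_monic T) => u0.
  by rewrite e u0 mulr0 monicE lead_coef0 eq_sym oner_eq0.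
have [sa | sa] : size s = a \/ (size s).+1 = a.
  move: sg su sT sgs u_gt0.
  by move: (size s) (size g) (size u) (size T) => i j k l; lia.
- exists (map Some s); rewrite size_map map_inj_uniq ?us; last by move=> x y [].
  by split=> //; rewrite eqp_sym.
- exists (None :: map Some s).
  rewrite /= size_map map_inj_uniq ?us; last by move=> x y [].
  split=> //; last by rewrite eqp_sym.
  by rewrite andbT; apply/mapP=> -[].
Qed.

(** * Squarefree members of pencils in characteristic zero *)

Section CharZero.
Hypothesis charK : [pchar K] =i pred0.

Lemma deriv_eq0 p : p^`() = 0 -> (size p <= 1)%N.
Proof.
move=> dp; apply/leq_sizeP => -[//|i] _.
have := congr1 (fun q : {poly K} => q`_i) dp; rewrite coef_deriv coef0.
move/eqP; rewrite -mulr_natr mulf_eq0 => /orP[/eqP //|].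
by rewrite (pcharf0P K).1.
Qed.

(** When the Wronskian vanishes, [f] divides its own derivative, which has smaller degree and is
    therefore zero. *)
Lemma coprimep_deriv f g : coprimep f g -> f^`() * g = f * g^`() ->
  (size f <= 1)%N.
Proof.
move=> cop e; apply: deriv_eq0; apply/eqP/negPn/negP => df.
have : f %| f^`() by rewrite -(Gauss_dvdpl _ cop) e dvdp_mulr.
have f0 : f != 0 by apply: contra df => /eqP->; rewrite deriv0.
by move/(dvdp_leq df); rewrite leqNgt lt_size_deriv.
Qed.

(* A multiple root [x] of [f + c g] is a root of the Wronskian of [f] and [g],
   and determines [c] since [g] does not vanish at [x]. *)
Lemma pencil_separable f g : coprimep f g -> (1 < size f)%N || (1 < size g)%N ->
  exists s : seq K, forall c, c \notin s -> separable_poly (f + c *: g).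
Proof.
move=> cop sfg; pose W := f^`() * g - f * g^`().
have W0 : W != 0.
  rewrite subr_eq0; apply: contraL sfg => /eqP e; rewrite negb_or -!leqNgt.
  rewrite (coprimep_deriv cop e) (@coprimep_deriv g f) // 1?coprimep_sym //.
  by rewrite mulrC -e mulrC.
have [rs WE] := closed_field_poly_normal W.
exists [seq - (f.[x] / g.[x]) | x <- rs] => c cs.
rewrite unlock; apply: closed_coprimep => x /rootP.
rewrite derivD derivZ !hornerE => fx.
apply/negP => /eqP dx.
have gx : g.[x] != 0.
  apply/negP => /eqP gx; have fx0 : root f x.
    by apply/rootP; rewrite -fx gx mulr0 addr0.
  by have := coprimep_root cop fx0; rewrite gx eqxx.
case/mapP: cs; exists x.
  rewrite -root_prod_XsubC.
  rewrite -(rootZ _ _ (_ : lead_coef W != 0)) ?lead_coef_eq0 //.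
  rewrite -WE rootE !hornerE; apply/eqP.
  have -> : f.[x] = - (c * g.[x]) by apply/eqP; rewrite -addr_eq0 fx.
  have -> : f^`().[x] = - (c * g^`().[x]) by apply/eqP; rewrite -addr_eq0 dx.
  by ring.
have -> : f.[x] = - (c * g.[x]) by apply/eqP; rewrite -addr_eq0 fx.
by rewrite mulNr opprK mulfK.
Qed.

Lemma separable_form_of p : separable_poly p -> p != 0 ->
  exists T, [/\ uniq T, size T = (size p).-1 & form_of T %= p].
Proof.
move=> sepp p0; have [rs pE] := closed_field_poly_normal p.
have lp0 : lead_coef p != 0 by rewrite lead_coef_eq0.
have urs : uniq rs.
  rewrite -separable_prod_XsubC.
  by rewrite -(eqp_separable (eqp_scale _ lp0)) -pE.
exists (map Some rs); rewrite map_inj_uniq ?size_map; last by move=> x y [].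
rewrite {1 2}pE size_scale // size_prod_XsubC; split=> //.
by rewrite form_of_map_Some eqp_sym eqp_scale.
Qed.

Lemma pencil_form_of f g b : (0 < b)%N -> coprimep f g ->
    (size f <= b.+1)%N -> (size g <= b.+1)%N ->
    (b < size f)%N || (b < size g)%N ->
  exists s : seq K, forall c, c \notin s ->
    exists T, [/\ uniq T, size T = b & form_of T %= f + c *: g].
Proof.
move=> b_gt0 cop sf sg sfg.
have [|s sP] := pencil_separable cop; first by lia.
(* The added value is where the coefficient of degree [b] cancels; avoiding it keeps all [b] zeros
   affine. *)
exists (- (f`_b / g`_b) :: s) => c; rewrite inE negb_or => /andP[cb /sP sepc].
have coefb (h : {poly K}) : (size h <= b.+1)%N -> (b < size h)%N = (h`_b != 0).
  move=> sh; apply/idP/idP => [hb | hb]; last first.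
    by rewrite ltnNge; apply: contra hb => hb; rewrite nth_default.
  have sE : size h = b.+1 by lia.
  by rewrite -[b]/(b.+1.-1) -sE -lead_coefE lead_coef_eq0 -size_poly_gt0 sE.
have sfcg : (size (f + c *: g)%R <= b.+1)%N.
  rewrite (leq_trans (size_polyD _ _)) // geq_max sf.
  by rewrite (leq_trans (size_scale_leq _ _)).
have : (b < size (f + c *: g)%R)%N.
  rewrite coefb // coefD coefZ addr_eq0; apply: contra cb => /eqP fb.
  move: sfg; rewrite !coefb // fb; have [-> | gb _] := eqVneq g`_b 0.
    by rewrite mulr0 oppr0 eqxx.
  by rewrite mulNr opprK mulfK.
move=> sb; have sE : size (f + c *: g) = b.+1 by lia.
have [|T [uT sT TE]] := separable_form_of sepc.
  by rewrite -size_poly_gt0 sE.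
by exists T; rewrite sT sE.
Qed.


(* For [size T > d] the subtraction gives [0] and the condition is vacuous, as
   it should be: [d.+1] points of the curve span P^d. *)
Definition apolar (d : nat) (L : {scalar {poly K}}) T : Prop :=
  annihilates L (d.+1 - size T) (form_of T).

(** * Minimal apolar sets and the functionals they determine *)

Section Apolar.
Variables (d : nat) (L : {scalar {poly K}}).
Hypothesis d_gt0 : (0 < d)%N.
Hypothesis L_neq0 : exists2 p : {poly K}, (size p <= d.+1)%N & L p != 0.

(** [a] is the least degree of an apolar form; it exists since in degree [d + 1] the condition is
    vacuous. The last clause is minimality at degree [a - 1]. *)
Lemma exists_first_generator : exists a, exists g1,
  [/\ (0 < a <= d.+1)%N, g1 != 0, (size g1 <= a.+1)%N,
      annihilates L (d.+1 - a) g1 &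
      forall f, (size f <= a)%N -> annihilates L (d.+2 - a) f -> f = 0].
Proof.
pose P k := `[< exists f, [/\ f != 0, (size f <= k.+1)%N &
  annihilates L (d.+1 - k) f] >].
have exP : exists k, P k.
  exists d.+1; apply/asboolP; exists 1; rewrite oner_eq0 size_poly1; split=> //.
  move=> u; rewrite subnn leqn0 size_poly_eq0 => /eqP ->.
  by rewrite mulr0 linear0.
have [p0 sp0 Lp0] := L_neq0.
case: (ex_minnP exP) => a /asboolP[g1 [g10 sg1 g1L]] amin.
have a_gt0 : (0 < a)%N.
  rewrite lt0n; apply: contra Lp0 => /eqP a0; move: sg1 g1L.
  rewrite a0 subn0 => /size1_polyC gE g1L.
  have c0 : g1`_0 != 0 by apply: contra g10 => /eqP e; rewrite gE e.
  have := g1L _ sp0; rewrite gE mul_polyC linearZ /= => /eqP.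
  by rewrite mulf_eq0 (negPf c0).
exists a, g1; split=> //.
  rewrite a_gt0 amin //; apply/asboolP; exists 1.
  rewrite oner_eq0 size_poly1; split=> // u.
  by rewrite subnn leqn0 size_poly_eq0 => /eqP ->; rewrite mulr0 linear0.
move=> f sf fL; apply/eqP; apply: contraT => f0.
suff /amin : P a.-1 by rewrite leqNgt ltn_predL a_gt0.
apply/asboolP; exists f; split; rewrite ?prednK //.
by rewrite (_ : d.+1 - a.-1 = d.+2 - a)%N //; lia.
Qed.

(** Two distinct members of the pencil already span [f] and [g]. *)
Lemma annihilated_by_pencil (M : {scalar {poly K}}) n f g (s : seq K) :
  (forall c, c \notin s -> annihilates M n (f + c *: g)) ->
  annihilates M n f /\ annihilates M n g.
Proof.
move=> h; have [c cs] := exists_notin s; have [e es] := exists_notin (c :: s).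
move: es; rewrite inE negb_or => /andP[ec es].
have gM : annihilates M n g.
  move=> u su; have := congr2 (fun x y => x - y) (h e es u su) (h c cs u su).
  rewrite subrr -linearB -mulrBl opprD addrACA subrr add0r -scalerBl.
  rewrite -scalerAl linearZ /= => /eqP; rewrite mulf_eq0 subr_eq0 (negPf ec).
  by move/eqP.
split=> // u su; have := h c cs u su.
by rewrite mulrDl linearD -scalerAl linearZ /= gM // mulr0 addr0.
Qed.

Lemma annihilates_form_of T n (M : {scalar {poly K}}) g :
  form_of T %= g -> annihilates M n g <-> annihilates M n (form_of T).
Proof.
have aux p q : p %= q -> annihilates M n p -> annihilates M n q.
  rewrite eqp_sym => /eqpf_eq[c c0 qE] pM u su.
  by rewrite qE -scalerAl linearZ /= pM ?mulr0.
by move=> e; split; apply: aux; rewrite // eqp_sym.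
Qed.

(** Pencils are controlled only for cofactors of full degree coprime to [g2]; differences of such
    cofactors reach every [w]. *)
Lemma generic_cofactor g2 k w : g2 != 0 -> (size w <= k.+1)%N ->
  exists w1 w2, [/\ w = w1 - w2, coprimep w1 g2, coprimep w2 g2 &
    size w1 = k.+1 /\ size w2 = k.+1].
Proof.
move=> g20 sw; have [rs g2E] := closed_field_poly_normal g2.
have rootg2 x : root g2 x = (x \in rs).
  by rewrite g2E rootZ ?lead_coef_eq0 // root_prod_XsubC.
have [t trs] := exists_notin rs.
pose l : {poly K} := ('X - t%:P) ^+ k.
have sl : size l = k.+1 by rewrite size_exp_XsubC.
have l0 x : x \in rs -> l.[x] != 0.
  move=> xrs; rewrite horner_exp !hornerE expf_neq0 // subr_eq0.
  by apply: contra trs => /eqP <-.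
(* The excluded values are those where [c *: l] vanishes, where [w + c *: l] loses its top
   coefficient, and where it vanishes at a root of [g2]. *)
have [c] := exists_notin (0 :: - w`_k :: [seq - (w.[x] / l.[x]) | x <- rs]).
rewrite !inE !negb_or => /and3P[c0 cw crs].
exists (w + c *: l), (c *: l); rewrite addrK size_scale // sl; split=> //.
- rewrite coprimep_sym; apply: closed_coprimep => x; rewrite rootg2 => xrs.
  rewrite hornerD hornerZ; apply: contra crs; rewrite addr_eq0 => /eqP e.
  by apply/mapP; exists x; rewrite // e mulNr opprK mulfK ?l0.
- rewrite coprimep_sym; apply: closed_coprimep => x; rewrite rootg2 => xrs.
  by rewrite hornerZ mulf_neq0 ?l0.
split=> //; apply/eqP; rewrite eqn_leq.
rewrite (leq_trans (size_polyD _ _)) ?geq_max ?sw ?size_scale ?sl //=.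
rewrite ltnNge; apply: contra cw => /leq_sizeP/(_ k (leqnn _)) /eqP.
rewrite coefD coefZ (_ : l`_k = 1); last first.
  by have /monicP := monic_exp k (monicXsubC t); rewrite lead_coefE -/l sl.
by rewrite mulr1 addrC addr_eq0.
Qed.

(** Algebraic core of the theorem: [L] stands for [q], and [M] for a point in the span of every
    minimal set. *)
Theorem apolar_minimal_proportional T1 T2 (M : {scalar {poly K}}) :
    uniq T1 -> uniq T2 -> size T1 = size T2 -> ~ (T1 =i T2) ->
    apolar d L T1 -> apolar d L T2 ->
    (forall T, uniq T -> apolar d L T -> (size T1 <= size T)%N) ->
    (forall T, uniq T -> size T = size T1 -> apolar d L T -> apolar d M T) ->
  exists c, forall p : {poly K}, (size p <= d.+1)%N -> M p = c * L p.
Proof.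
move=> u1 u2 s12 n12 L1 L2 rmin LM; set r := size T1 in s12 rmin LM.
have [a [g1 [/andP[a_gt0 a_le] g10 sg1 g1L nondeg]]] := exists_first_generator.
pose b := (d.+2 - a)%N; have abE : (a + b = d.+2)%N by rewrite /b; lia.
have bE : (d.+1 - a = b.-1)%N by rewrite /b; lia.
rewrite -/b in nondeg; rewrite bE in g1L.
have leab : (a <= b)%N := nondeg_leq nondeg.
have b_gt0 : (0 < b)%N by lia.
have [g2 [sg2 g2L g2n]] := exists_second_generator nondeg g10 sg1 a_gt0.
have g20 : g2 != 0.
  by apply/eqP => e; apply: (g2n 0); rewrite ?size_poly0 ?mulr0.
(* A common root would make [g2] a multiple of [g1], against [g2n]. *)
have cop : coprimep g1 g2.
  apply: closed_coprimep => x; rewrite root_factor_theorem => /dvdpP[h1 e1].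
  apply/negP; rewrite -rootE root_factor_theorem => /dvdpP[h2 e2].
  have sl := size_XsubC x; rewrite mulrC in e1; rewrite mulrC in e2.
  have h10 : h1 != 0 by apply: contra g10 => /eqP h; rewrite e1 h mulr0.
  have h20 : h2 != 0 by apply: contra g20 => /eqP h; rewrite e2 h mulr0.
  have [] := @no_common_factor _ L a b h1 h2 ('X - x%:P) a_gt0 nondeg.
  - by rewrite -e1.
  - by rewrite -e2.
  - by rewrite polyXsubC_eq0.
  - by rewrite sl.
  - by [].
  - by move: sg1; rewrite e1 size_mul ?polyXsubC_eq0 // sl.
  - by move: sg2; rewrite e2 size_mul ?polyXsubC_eq0 // sl.
  by rewrite -e1 -e2 => w e sw; apply: (g2n w).
(* Coprimality at infinity, where the common linear factor is encoded by [l = 1]. *)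
have full : (a < size g1)%N || (b < size g2)%N.
  apply: contraT; rewrite negb_or -!leqNgt => /andP[s1 s2].
  have [] := @no_common_factor _ L a b g1 g2 1 a_gt0 nondeg.
  - by rewrite mul1r.
  - by rewrite mul1r.
  - exact: oner_neq0.
  - by rewrite size_poly1.
  - by [].
  - by [].
  - by [].
  by rewrite !mul1r => w e sw; case: (g2n w).
have divr T : uniq T -> form_of T %= g1 -> size T = a -> (r <= a)%N.
  move=> uT gT sT; rewrite -sT; apply: rmin => //.
  by rewrite /apolar sT bE; apply/(annihilates_form_of _ _ gT).
(* Here [g1] divides a squarefree form, so it comes from [a] points; minimality gives [r <= a] and
   the quotient is constant. *)
have small_form T : uniq T -> apolar d L T -> size T = r -> (r < b)%N ->
    form_of T %= g1.
  move=> uT LT sT rb.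
  have [|u su|w e sw] :=
    annihilated_multiple_low nondeg g10 sg1 g1L rb (g := form_of T).
  - by rewrite size_form_of // sT; case: (_ \notin _); rewrite /=; lia.
  - by apply: LT; rewrite sT; apply: leq_trans su _; lia.
  have [|T' [uT' sT' eT']] := form_of_divisor uT e sg1; first by rewrite sT.
  have ra := divr _ uT' eT' sT'.
  rewrite e -{2}[g1]mulr1 eqp_mull //.
  have w0 : w != 0.
    apply: contraTneq (form_of_monic T) => w0.
    by rewrite e w0 mulr0 monicE lead_coef0 eq_sym oner_eq0.
  rewrite -size_poly_eq1 eqn_leq size_poly_gt0 w0 andbT.
  by apply: leq_trans sw _; lia.
have r_ge : (b <= r)%N.
  rewrite leqNgt; apply/negP=> rb; case: n12.
  have e1 := small_form _ u1 L1 erefl rb.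
  have e2 := small_form _ u2 L2 (esym s12) rb.
  by apply: form_of_inj => //; apply: eqp_trans e1 _; rewrite eqp_sym.
(* A nonzero form of degree 1 is the form of a single point, so [a = 1] would give [r <= 1], whereas
   then [b = d + 1 > 1]. *)
have a_gt1 : (1 < a)%N.
  rewrite ltnNge; apply/negP => a1.
  have {a1} aE : a = 1%N by lia.
  suff [T [uT sT eT]] : exists T, [/\ uniq T, size T = a & form_of T %= g1].
    by have := divr _ uT eT sT; lia.
  have [sg|sg] := eqVneq (size g1) 1%N.
    exists [:: None]; rewrite aE; split=> //.
    by rewrite /form_of /= big_nil eqp_sym -size_poly_eq1 sg.
  have [x] := closed_rootP g1 sg.
  rewrite root_factor_theorem => xg; exists [:: Some x]; rewrite aE; split=> //.
  rewrite /form_of /= big_seq1 -dvdp_size_eqp // size_XsubC.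
  have : (0 < size g1)%N by rewrite size_poly_gt0.
  by move: sg sg1; rewrite aE; case: (size g1) => [|[|[]]].
have pencil w : coprimep w g2 -> size w = (b - a).+1 -> exists s : seq K,
    forall c, c \notin s -> exists T,
    [/\ uniq T, size T = b, form_of T %= g1 * w + c *: g2 & apolar d L T].
  move=> copw sw; have w0 : w != 0 by rewrite -size_poly_gt0 sw.
  have sgw : size (g1 * w) = (size g1 + (b - a))%N.
    by rewrite size_mul // sw addnS.
  have [|||s sP] := @pencil_form_of (g1 * w) g2 b b_gt0 _ _ sg2.
  - by rewrite coprimepMl cop.
  - by rewrite sgw; lia.
  - by case/orP: full => h; apply/orP; [left|right] => //; rewrite sgw; lia.
  exists s => c /sP[T [uT sT eT]]; exists T; split=> //.
  rewrite /apolar sT; apply/(annihilates_form_of _ _ eT) => u su.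
  have su' : (size u <= a.-1)%N by lia.
  rewrite mulrDl linearD -scalerAl linearZ /= g2L // mulr0 addr0 -mulrA.
  rewrite g1L // (leq_trans (size_mul_leqS (m := (b - a)%N) _ su')) ?sw //.
  by lia.
have generic w : (size w <= (b - a).+1)%N -> exists w1 w2, [/\ w = w1 - w2,
    coprimep w1 g2, coprimep w2 g2 &
    size w1 = (b - a).+1 /\ size w2 = (b - a).+1].
  exact: generic_cofactor.
have rE : r = b.
  apply/eqP; rewrite eqn_leq r_ge andbT.
  have [|w [_ [_ cw _ [sw _]]]] := generic 0; first by rewrite size_poly0.
  have [s sP] := pencil w cw sw; have [c /sP[T [uT sT _ LT]]] := exists_notin s.
  by rewrite -sT rmin.
have M12 w : coprimep w g2 -> size w = (b - a).+1 ->
    annihilates M a.-1 (g1 * w) /\ annihilates M a.-1 g2.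
  move=> cw sw; have [s sP] := pencil w cw sw.
  apply: (@annihilated_by_pencil _ _ _ _ s) => c /sP[T [uT sT eT LT]].
  apply/(annihilates_form_of _ _ eT); have := LM T uT (etrans sT (esym rE)) LT.
  by rewrite /apolar sT (_ : d.+1 - b = a.-1)%N //; lia.
have g2M : annihilates M a.-1 g2.
  have [|w [_ [_ cw _ [sw _]]]] := generic 0; first by rewrite size_poly0.
  by case: (M12 w cw sw).
have g1M : annihilates M b.-1 g1.
  apply: annihilatesXn => i.
  have gwM w : (size w <= (b - a).+1)%N -> annihilates M a.-1 (g1 * w).
    move=> /generic[w1 [w2 [-> c1 c2 [s1 s2]]]] u su.
    have [h1 _] := M12 _ c1 s1; have [h2 _] := M12 _ c2 s2.
    by rewrite mulrBr mulrBl linearB /= h1 ?h2 ?subrr.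
  (* ['X^i] with [i < b - 1] splits into a cofactor of degree at most [b - a] and one of degree at
     most [a - 2]; for small [i] the latter is 1, which uses [a > 1]. *)
  have := ltn_ord i; have [lei | lti] := leqP i (b - a) => ltib.
    by rewrite -[_ * _]mulr1 gwM ?size_polyXn ?size_poly1 //; lia.
  rewrite -(subnKC (ltnW lti)) exprD mulrA gwM ?size_polyXn //; lia.
have lenE : (d.+1 = (a + b).-1)%N by lia.
rewrite lenE; apply: (annihilators_proportional a_gt0 b_gt0 cop) => //.
by rewrite -lenE.
Qed.

End Apolar.
End CharZero.
End BinaryForms.

(** * Duality between points of the space and functionals on forms *)

Section Geometry.
Variables (K : closedFieldType) (d : nat).
Implicit Types (v : 'rV[K]_d.+1) (p u : {poly K}) (T : seq (option K)).

(** The apolarity pairing; coefficients of [p] beyond degree [d] are ignored. *)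
Definition functional v p : K := (v *m (poly_rV p)^T) 0 0.

Lemma functional_scalar v : scalar (functional v).
Proof.
move=> c p u; rewrite /functional linearP /= linearP /= mulmxDr -scalemxAr.
by rewrite !mxE.
Qed.

HB.instance Definition _ v :=
  GRing.isLinear.Build K {poly K} K *%R (functional v) (functional_scalar v).

Lemma functionalE v p : functional v p = \sum_(i < d.+1) v 0 i * p`_i.
Proof. by rewrite /functional mxE; apply: eq_bigr => i _; rewrite !mxE. Qed.

Lemma functional_Xn v (i : 'I_d.+1) : functional v 'X^i = v 0 i.
Proof.
rewrite functionalE (bigD1 i) //= big1 => [|j ji]; rewrite coefXn.
  by rewrite eqxx mulr1 addr0.
by rewrite val_eqE (negPf ji) mulr0.
Qed.

Definition curve_vector (x : option K) : 'rV[K]_d.+1 :=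
  if x is Some t then veronese d 1 t else veronese d 0 1.

(** A form of degree [d] takes its coefficient of ['X^d] as value at infinity. *)
Definition form_eval (x : option K) p : K :=
  if x is Some t then p.[t] else p`_d.

Lemma functional_curve_vector x p : (size p <= d.+1)%N ->
  functional (curve_vector x) p = form_eval x p.
Proof.
move=> sp; rewrite functionalE; case: x => [t|] /=.
  rewrite (horner_coef_wide _ sp); apply: eq_bigr => i _.
  by rewrite mxE expr1n mul1r mulrC.
rewrite big_ord_recr /= big1 => [|i _]; rewrite mxE expr1n.
  by rewrite subnn expr0 !mul1r add0r.
by rewrite expr0n /= subn_eq0 leqNgt ltn_ord !mul0r.
Qed.

Lemma curve_vector_neq0 x : curve_vector x != 0.
Proof.
apply/eqP => h.
have z p : functional (curve_vector x) p = 0.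
  by rewrite h functionalE big1 // => i _; rewrite mxE mul0r.
case: x {h} z => [t|] z.
  have := functional_curve_vector (Some t) (p := 1); rewrite z size_poly1.
  by move=> /(_ isT)/esym/eqP; rewrite /= hornerC oner_eq0.
have := functional_curve_vector None (p := 'X^d); rewrite z size_polyXn.
by move=> /(_ (leqnn _))/esym/eqP; rewrite /= coefXn eqxx oner_eq0.
Qed.

(** Affine zeros split off as linear factors, and a zero at infinity lowers the degree of [p] by
    one. *)
Lemma form_evals_eq0 T p : uniq T -> (size p <= d.+1)%N ->
  (forall x, x \in T -> form_eval x p = 0) ->
  exists2 u, p = form_of T * u & (size u <= d.+1 - size T)%N.
Proof.
move=> uT sp h; have [->|p0] := eqVneq p 0.
  by exists 0; rewrite ?mulr0 ?size_poly0.
have : form_of T %| p.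
  apply: uniq_roots_dvdp.
    apply/allP => x; rewrite mem_pmap map_id => xT.
    by apply/rootP; apply: h xT.
  by rewrite uniq_rootsE (@pmap_uniq _ _ id Some) //; case.
case/dvdpP => u pE.
have u0 : u != 0 by apply: contra p0 => /eqP e; rewrite pE e mul0r.
exists u; first by rewrite mulrC.
have sE : size p = ((size T + (None \notin T)).-1 + size u)%N.
  have sT : (0 < size T + (None \notin T))%N.
    by rewrite -size_form_of // size_poly_gt0 monic_neq0 ?form_of_monic.
  rewrite pE size_mul ?size_form_of //; last first.
    by rewrite monic_neq0 ?form_of_monic.
  by rewrite addnC -[in LHS](prednK sT).
case: (boolP (None \in T)) sE => [nT | nT] /= sE; last first.
  move: sp; rewrite sE addn1 => sp.
  by rewrite leq_subRL ?(leq_trans _ sp) ?leq_addr.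
have sp' : (size p <= d)%N.
  rewrite leqNgt; apply/negP => lt; have e : size p = d.+1 by lia.
  have := h _ nT; rewrite /= -[d]/(d.+1.-1) -e => /eqP.
  by rewrite -lead_coefE lead_coef_eq0 (negPf p0).
have : (0 < size T)%N by case: (T) nT.
by move: sE sp'; move: (size p) (size T) (size u) => i j k; lia.
Qed.

Lemma form_eval_multiple T u : uniq T -> (size u <= d.+1 - size T)%N ->
  (size (form_of T * u)%R <= d.+1)%N /\
  forall x, x \in T -> form_eval x (form_of T * u) = 0.
Proof.
move=> uT su; have [->|u0] := eqVneq u 0.
  rewrite mulr0 size_poly0; split=> // -[t|] _ /=; first by rewrite hornerE.
  by rewrite coef0.
have su0 : (0 < size u)%N by rewrite size_poly_gt0.
have sE := size_form_of uT; have sle := size_polyMleq (form_of T) u.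
rewrite sE in sle; split.
  apply: leq_trans sle _; move: su su0; case: (None \notin T);
  by move: (size T) (size u) => i j; lia.
case=> [t tT | nT] /=.
  by apply/rootP; rewrite rootM root_form_of tT.
rewrite nT /= in sle; rewrite nth_default // (leq_trans sle) //.
by move: su su0; move: (size T) (size u) => i j; lia.
Qed.

(** The columns of the matrix of [1 - projv U] are linear forms vanishing on [U], and their common
    kernel is [U]. *)
Lemma vspace_dual (U : {vspace 'rV[K]_d.+1}) v :
  (forall c : 'cV[K]_d.+1, (forall w, w \in U -> w *m c = 0) -> v *m c = 0) ->
  v \in U.
Proof.
move=> h; pose f := (\1 - projv U)%VF; pose C := lin1_mx f.
have fC w : w *m C = w - projv U w.
  by rewrite mul_rV_lin1 /= add_lfunE opp_lfunE id_lfunE.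
have vC : v *m C = 0.
  apply/rowP => j; have vC0 : col j (v *m C) = 0.
    rewrite colE -mulmxA -colE; apply: h => w wU.
    by rewrite colE mulmxA fC projv_id // subrr mul0mx.
  by have := congr1 (fun A : 'cV_1 => A 0 0) vC0; rewrite !mxE.
by rewrite -(subrK (projv U v) v) -fC vC add0r memv_proj.
Qed.

Lemma vline_scale c v : c != 0 -> <[c *: v]>%VS = <[v]>%VS.
Proof.
move=> c0; apply/eqP.
rewrite eqEdim -memvE memvZ ?memv_line //=.
by rewrite !dim_vline scaler_eq0 (negPf c0).
Qed.

Section Curve.
Variable g : 'M[K]_d.+1.
Hypothesis g_unit : g \in unitmx.

Lemma mul_unit_neq0 v : v != 0 -> v *m g != 0.
Proof. by apply: contra => /eqP h; rewrite -(mulmxK g_unit v) h mul0mx. Qed.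

Fact curve_line_dim x : \dim <[curve_vector x *m g]>%VS == 1%N.
Proof. by rewrite dim_vline mul_unit_neq0 ?curve_vector_neq0. Qed.

Definition curve_point x : proj_space K d := ProjPoint (curve_line_dim x).

Lemma proj_line_vector (q : proj_space K d) :
  exists2 v, v != 0 & proj_line q = <[v *m g]>%VS.
Proof.
case: q => U /= /eqP dU; have U0 : U != 0%VS by rewrite -dimv_eq0 dU.
exists (vpick U *m invmx g).
  have := U0; rewrite -vpick0; apply: contra => /eqP h.
  by rewrite -(mulmxKV g_unit (vpick U)) h mul0mx.
rewrite mulmxKV //; apply/esym/eqP.
by rewrite eqEdim -memvE memv_pick dU dim_vline vpick0 U0.
Qed.

(** Linear forms on the space, pulled back by [g], are the forms of degree [d]; those vanishing on
    the points of [T] are the multiples of [form_of T]. *)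
Lemma linear_span_apolar (q : proj_space K d) v T :
    uniq T -> proj_line q = <[v *m g]>%VS ->
  linear_span [set z | z \in map curve_point T] q <-> apolar d (functional v) T.
Proof.
move=> uT qE; split=> [span u su | ap U TU].
  have [sTu Tu] := form_eval_multiple uT su.
  pose c : 'cV[K]_d.+1 := invmx g *m (poly_rV (form_of T * u))^T.
  have gc w : w *m g *m c = w *m (poly_rV (form_of T * u))^T.
    by rewrite mulmxA mulmxK.
  pose f : 'Hom('rV[K]_d.+1, 'rV[K]_1) := linfun (mulmxr c).
  have /= := span (lker f); rewrite qE -memvE memv_ker lfunE /= gc => vc.
  rewrite /functional (eqP (vc _)) ?mxE // => p /mapP[x xT ->].
  rewrite /= -memvE memv_ker lfunE /= gc; apply/eqP/rowP => j.
  by rewrite ord1 [RHS]mxE -/(functional _ _) functional_curve_vector // Tu.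
rewrite qE -memvE; apply: vspace_dual => c cU.
pose p := rVpoly (g *m c)^T.
have pE w : functional w p = (w *m g *m c) 0 0.
  by rewrite /functional rVpolyK trmxK mulmxA.
have sp : (size p <= d.+1)%N by apply: size_poly.
have [x xT | u pu su] := form_evals_eq0 uT sp.
  rewrite -functional_curve_vector // pE cU ?mxE // memvE.
  exact: (TU (curve_point x) (map_f _ xT)).
by apply/rowP => j; rewrite ord1 -pE pu ap // mxE.
Qed.

End Curve.

(** The parameter of a pair [(s, t)] is [t / s], or infinity when [s = 0]. *)
Lemma rational_normal_curveP (X : set (proj_space K d)) :
  rational_normal_curve X ->
  exists2 g : 'M[K]_d.+1, g \in unitmx &
    exists pt : option K -> proj_space K d,
      [/\ forall x, X (pt x),
       forall z : proj_space K d, X z -> exists x, z = pt x &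
       forall q v T, uniq T -> proj_line q = <[v *m g]>%VS ->
         linear_span [set z | z \in map pt T] q <-> apolar d (functional v) T].
Proof.
case=> g gU ->; exists g => //; exists (curve_point gU); split.
- case=> [t|]; [exists 1, t | exists 0, 1]; split=> //.
    by rewrite xpair_eqE oner_eq0.
  by rewrite xpair_eqE oner_eq0 andbF.
- move=> p [s [t [st pE]]].
  suff [x [c c0 e]] :
      exists x, exists2 c, c != 0 & veronese d s t = c *: curve_vector x.
    exists x; apply: val_inj; rewrite /= pE e -scalemxAl.
    exact: vline_scale.
  have [s0|s0] := eqVneq s 0.
    exists None, (t ^+ d).
      by rewrite expf_neq0 //; apply: contra st => /eqP->; rewrite s0.
    apply/rowP => i; rewrite !mxE s0 expr1n mulr1 mulrC.
    have [/eqP di|di] := boolP (d - i == 0)%N.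
      by rewrite di expr0 !mulr1; congr (_ ^+ _); have := ltn_ord i; lia.
    by rewrite expr0n (negPf di) !mulr0.
  exists (Some (t / s)), (s ^+ d); first by rewrite expf_neq0.
  apply/rowP => i; rewrite !mxE expr1n mul1r expr_div_n.
  have le : (i <= d)%N by rewrite -ltnS.
  have -> : s ^+ d = s ^+ (d - i) * s ^+ i by rewrite -exprD subnK.
  by rewrite -mulrA [t ^+ i / _]mulrC mulVKf ?expf_neq0.
- by move=> q v T; apply: linear_span_apolar.
Qed.

End Geometry.

(** * Minimal spanning sets *)

Section Rank.
Variables (K : fieldType) (d : nat).
Implicit Types (X : set (proj_space K d)) (q : proj_space K d)
  (S : {fset proj_space K d}).

(** On either side [S] spans [q], which rules out the default value of [X_rank]. *)
Lemma rank_setsP X q S : rank_sets X q S <-> spanning_set X q S /\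
  forall S', spanning_set X q S' -> (#|` S| <= #|` S'|)%N.
Proof.
rewrite /rank_sets /X_rank /=; case: pselect => [exn | nex]; last first.
  by split=> -[spS _]; case: nex; exists #|` S|; apply/asboolP; exists S.
case: ex_minnP => m /asboolP[S0 spS0 <-] min; split=> -[spS h]; split=> //.
  by move=> S' spS'; rewrite h; apply: min; apply/asboolP; exists S'.
apply/eqP; rewrite eqn_leq h //= min //; by apply/asboolP; exists S.
Qed.

Lemma rank_sets_nonempty X q S :
  spanning_set X q S -> exists S', rank_sets X q S'.
Proof.
move=> spS.
have ex : exists n, `[< exists2 S, spanning_set X q S & #|` S| = n >].
  by exists #|` S|; apply/asboolP; exists S.
case: (ex_minnP ex) => m /asboolP[S0 spS0 <-] min; exists S0.
apply/rank_setsP; split=> // S' spS'; apply: min; by apply/asboolP; exists S'.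
Qed.

Lemma map_preimage (I Z : eqType) (pt : I -> Z) (s : seq Z) :
  (forall p, p \in s -> exists x, p = pt x) -> exists T, s = map pt T.
Proof.
elim: s => [|p s IH] h; first by exists [::].
have [T ->] : exists T, s = map pt T.
  by apply: IH => p' sp'; apply: h; rewrite inE sp' orbT.
by have [|x ->] := h p; [rewrite inE eqxx | exists (x :: T)].
Qed.

End Rank.

(** * Translation of the algebraic result back to points *)

Theorem theorem2 (K : closedFieldType) (hK : [pchar K] =i pred0)
    (d : nat) (hd : (2 <= d)%N)
    (X : set (proj_space K d)) (hX : rational_normal_curve X)
    (q : proj_space K d)
    (hq : ~ exists S : {fset proj_space K d}, rank_sets X q = [set S]) :
  rank_locus X q = [set q] /\
  (forall q' : proj_space K d, rank_sets X q = rank_sets X q' -> q' = q).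
Proof.
have locus_self q' : rank_locus X q' q' by move=> S [[]].
(* This also gives the second claim: equal families of minimal sets have equal loci, and [q'] lies
   in its own. *)
suff locusE q' : rank_locus X q q' -> q' = q.
  split; first by apply/seteqP; split=> [q' /locusE | _ ->].
  move=> q' e; apply: locusE; rewrite /rank_locus e; exact: locus_self.
move=> lq'; have [g gU [pt [Xpt ptX span]]] := rational_normal_curveP hX.
have [v v0 vE] := proj_line_vector gU q.
have [v' v'0 v'E] := proj_line_vector gU q'.
have spanning T : uniq T -> apolar d (functional v) T ->
    exists S : {fset proj_space K d}, [/\ spanning_set X q S,
      (#|` S| <= size T)%N & [set` S] = [set z | z \in map pt T]].
  move=> uT LT; exists [fset p in map pt T]%fset.
  have SE : [set` [fset p in map pt T]%fset] = [set z | z \in map pt T].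
    by apply/seteqP; split=> p /=; rewrite inE.
  split=> //; last by rewrite card_fseq -(size_map pt T) size_undup.
  split; last by rewrite SE; apply/(span _ _ _ uT vE).
  by rewrite SE => p /mapP[x _ ->].
have enum_spanning S : spanning_set X q S ->
    exists T, [/\ uniq T, size T = #|` S|, (S : seq _) = map pt T &
      apolar d (functional v) T].
  case=> SX qS; have [p pS|T TE] := @map_preimage _ _ pt (S : seq _).
    by apply: ptX; apply: SX.
  have uT : uniq T by apply: (@map_uniq _ _ pt); rewrite -TE fset_uniq.
  exists T; split=> //; first by rewrite -(size_map pt) -TE.
  apply/(span _ _ _ uT vE); rewrite -TE.
  by rewrite (_ : [set p | p \in (S : seq _)] = [set` S]).
have L_neq0 : exists2 p : {poly K}, (size p <= d.+1)%N & functional v p != 0.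
  have /rV0Pn[i vi] := v0; exists 'X^i; first by rewrite size_polyXn.
  by rewrite functional_Xn.
(* Any [d + 1] points of the curve span [q], apolarity being vacuous for them. *)
have [S1 rS1] : exists S, rank_sets X q S.
  have [s [us ss]] := exists_uniq_seq K d.+1.
  have [||S [spS _ _]] := spanning (map Some s).
  - by rewrite map_inj_uniq // => x y [].
  - move=> u; rewrite size_map ss subnn leqn0 size_poly_eq0 => /eqP ->.
    by rewrite mulr0 linear0.
  exact: rank_sets_nonempty spS.
have [S2 [rS2 S12]] : exists S2, rank_sets X q S2 /\ S2 <> S1.
  apply: contrapT => h; apply: hq; exists S1; apply/seteqP.
  split=> [S rS | _ ->] //.
  by apply: contrapT => n; apply: h; exists S.
have /rank_setsP[sp1 min1] := rS1; have /rank_setsP[sp2 min2] := rS2.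
have [T1 [uT1 sT1 T1E L1]] := enum_spanning _ sp1.
have [T2 [uT2 sT2 T2E L2]] := enum_spanning _ sp2.
have rank_min T : uniq T -> apolar d (functional v) T -> (size T1 <= size T)%N.
  move=> uT /(spanning _ uT)[S [spS cS _]]; rewrite sT1.
  exact: leq_trans (min1 _ spS) cS.
have [|||c cE] := @apolar_minimal_proportional _ hK d (functional v)
    (ltnW hd) L_neq0 T1 T2 (functional v') uT1 uT2 _ _ L1 L2 rank_min.
- by rewrite sT1 sT2; apply/eqP; rewrite eqn_leq min1 // min2.
- move=> T12; apply: S12; apply/fsetP => p.
  by rewrite -[_ \in S2]/(p \in (S2 : seq _)) -[_ \in S1]/(p \in (S1 : seq _))
    T1E T2E; apply/mapP/mapP => -[x xT ->]; exists x; rewrite // ?T12 // -T12.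
(* An apolar [T] of minimal size gives a minimal set, whose span contains [q']. *)
- move=> T uT sT LT; have [S [spS cS SE]] := spanning T uT LT.
  apply/(span _ _ _ uT v'E); rewrite -SE; apply: lq'.
  apply/rank_setsP; split=> //.
  by move=> S' spS'; apply: leq_trans cS _; rewrite sT sT1 min1.
have v'v : v' = c *: v.
  apply/rowP => i; rewrite mxE -!functional_Xn; apply: cE.
  by rewrite size_polyXn.
have c0 : c != 0 by apply: contra v'0 => /eqP c0; rewrite v'v c0 scale0r.
apply: val_inj; rewrite /= vE v'E v'v -scalemxAl; exact: vline_scale.
Qed.
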